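(* For $r>0$ and $y\in G$ let $\tilde B_r(y)=\bigcup_{s\in[-r,r]}B_r\cdot(O_sy)$, where $B_r=\{x\in G:\ |x|<r\}$. There exist constants $C,k>0$ such that for all $x,y\in G$ and $t>0$: $$\tilde B_t(y)\cap\tilde B_t(x)\neq\emptyset\ \Longrightarrow\ \tilde B_t(y)\subseteq\tilde B_{kt}(x),$$ $$\mu(\tilde B_{2t}(x))\le C\,\mu(\tilde B_t(x)).$$
   Context: $G$ is a connected and simply connected nilpotent Lie group with Lie algebra $\mathfrak g$, $\dim\mathfrak g=n\ge2$, identified with $\mathfrak g$ via the exponential map; thus $G$ is the vector space $\mathfrak g$ with the product given by the Campbell–Hausdorff formula, the neutral element is $0$, $x^{-1}=-x$, and $\mathrm{Aut}\,G=\mathrm{Aut}\,\mathfrak g\subseteq \mathrm{GL}(\mathfrak g)$. $A$ is a diagonalizable linear operator on $\mathfrak g$ with positive eigenvalues such that the maps $D_t=\exp(A\log t)$, $t>0$ (dilations), are automorphisms. $O:\mathbb R\to\mathrm{Aut}(G)$, $t\mapsto O_t$ (rotations), is a continuous homomorphism with relatively compact image, and rotations commute with dilations. $\mathfrak g$ (hence $G$) is linearly identified with $\mathbb R^n$ in such a way that $O_t\in\mathrm{SO}(n)$ for all $t$. $\mu$ is Lebesgue measure (a bi-invariant Haar measure). $|\cdot|:G\to[0,\infty)$ is a fixed rotation-invariant homogeneous norm: it is continuous, $|x|=0\Leftrightarrow x=0$, $|x^{-1}|=|x|$, $|D_tx|=t|x|$ for $t>0$, and $|O_tx|=|x|$ for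 all $t\in\mathbb R$, $x\in G$. $B_r\cdot z$ denotes $\{bz:\ b\in B_r\}$. *)

(* Defs.v *)
From HB Require Import structures.
From mathcomp Require Import all_boot all_order all_algebra.
From mathcomp Require Import all_classical all_reals all_analysis.
Set Implicit Arguments.
Unset Strict Implicit.
Unset Printing Implicit Defensive.
Import Order.TTheory GRing.Theory Num.Theory.
Import numFieldNormedType.Exports.
Local Open Scope classical_set_scope.
Local Open Scope ring_scope.

(* The underlying space R^n of the Lie algebra is 'rV[R]_n,
   and, as usual in MathComp, a linear operator is a matrix M : 'M[R]_n acting
   on row vectors by x |-> x *m M. *)

Section LieAlgebra.
Context {R : realType} {n : nat}.
Implicit Types (br mul : 'rV[R]_n -> 'rV[R]_n -> 'rV[R]_n) (x y z : 'rV[R]_n).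

Record is_lie_bracket br : Prop := {
  br_linearl : forall a x y z, br (a *: x + y) z = a *: br x z + br y z ;
  br_linearr : forall a x y z, br z (a *: x + y) = a *: br z x + br z y ;
  br_alt : forall x, br x x = 0 ;
  br_jacobi : forall x y z, br x (br y z) + br y (br z x) + br z (br x y) = 0 }.

Definition lspan (S : set 'rV[R]_n) : set 'rV[R]_n :=
  [set v | forall V : {vspace 'rV[R]_n}, S `<=` [set w | w \in V] -> v \in V].

Fixpoint lower_central br (m : nat) : set 'rV[R]_n :=
  if m is m'.+1 then
    lspan [set br z.1 z.2 | z in setT `*` lower_central br m']
  else setT.

Definition nilpotent_bracket br : Prop :=
  exists m, lower_central br m `<=` [set 0].

(* [z_1, [z_2, ... [z_(m-1), z_m]...]] *)
Fixpoint nested_bracket br (s : seq 'rV[R]_n) : 'rV[R]_n :=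
  if s is z :: s' then (if s' is [::] then z else br z (nested_bracket br s'))
  else 0.

(* the word x^r_1 y^s_1 ... x^r_k y^s_k, where (r_i, s_i) = p i *)
Definition ch_word (d k : nat) (p : {ffun 'I_k -> 'I_d.+1 * 'I_d.+1}) x y :
    seq 'rV[R]_n :=
  flatten [seq nseq (p i).1 x ++ nseq (p i).2 y | i <- enum 'I_k].

(* Homogeneous component of degree d of the Campbell-Hausdorff series
   log (exp x exp y), in Dynkin's form:
     sum_(k >= 1) (-1)^(k-1) / k
       sum_(r_i + s_i > 0, sum_i (r_i + s_i) = d)
         [x^r_1 y^s_1 ... x^r_k y^s_k] / (d r_1! s_1! ... r_k! s_k!).
   The constraints force k <= d and r_i, s_i <= d. *)
Definition ch_term br x y (d : nat) : 'rV[R]_n :=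
  \sum_(1 <= k < d.+1) ((-1) ^+ k.-1 / k%:R) *:
    \sum_(p : {ffun 'I_k -> 'I_d.+1 * 'I_d.+1} |
           [forall i, (0 < (p i).1 + (p i).2)%N] &&
           (\sum_i ((p i).1 + (p i).2) == d)%N)
      (d%:R * \prod_i (((p i).1)`!%:R * ((p i).2)`!%:R))^-1 *:
        nested_bracket br (ch_word p x y).

(* A connected and simply connected nilpotent Lie group, identified with its
   Lie algebra (R^n, br) by the exponential map. By nilpotency the
   Campbell-Hausdorff series has finitely many nonzero terms. *)
Record is_nilpotent_lie_group br mul : Prop := {
  nlg_bracket : is_lie_bracket br ;
  nlg_nilpotent : nilpotent_bracket br ;
  nlg_mulA : associative mul ;
  nlg_mul0l : left_id 0 mul ;
  nlg_mul0r : right_id 0 mul ;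
  nlg_mulNl : left_inverse 0 -%R mul ;
  nlg_mulNr : right_inverse 0 -%R mul ;
  nlg_mulE : forall x y, mul x y = limn (series (ch_term br x y)) }.

Definition lie_aut br : set 'M[R]_n :=
  [set M | M \in unitmx /\ forall x y, br x y *m M = br (x *m M) (y *m M)].

Definition special_orthogonal : set 'M[R]_n :=
  [set M | M *m M^T = 1%:M /\ \det M = 1].

Definition expmx (M : 'M[R]_n) : 'M[R]_n :=
  limn (series (fun k : nat => k`!%:R^-1 *: M ^+ k)).

Definition dilation (A : 'M[R]_n) (t : R) : 'M[R]_n := expmx (ln t *: A).

Record is_dilation_generator br (A : 'M[R]_n) : Prop := {
  dil_diag : diagonalizable A ;
  dil_eigen : forall a : R, eigenvalue A a -> 0 < a ;
  dil_aut : forall t : R, 0 < t -> lie_aut br (dilation A t) }.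

Record is_rotation_group br (A : 'M[R]_n) (O : R -> 'M[R]_n) : Prop := {
  rot_aut : forall t, lie_aut br (O t) ;
  rot_continuous : continuous O ;
  rot_hom : forall s t, O (s + t) = O s *m O t ;
  (* relative compactness in Aut G, not merely in the space of matrices *)
  rot_compact : exists K : set 'M[R]_n,
    [/\ compact K, K `<=` lie_aut br & range O `<=` K] ;
  rot_dilation : forall s t, 0 < t ->
    O s *m dilation A t = dilation A t *m O s ;
  rot_SO : forall t, special_orthogonal (O t) }.

Record is_homogeneous_norm (A : 'M[R]_n) (O : R -> 'M[R]_n)
    (N : 'rV[R]_n -> R) : Prop := {
  hnorm_ge0 : forall x, 0 <= N x ;
  hnorm_continuous : continuous N ;
  hnorm_eq0 : forall x, N x = 0 <-> x = 0 ;
  hnormV : forall x, N (- x) = N x ;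
  hnorm_dilation : forall t x, 0 < t -> N (x *m dilation A t) = t * N x ;
  hnorm_rotation : forall t x, N (x *m O t) = N x }.

Definition hball (N : 'rV[R]_n -> R) (r : R) : set 'rV[R]_n :=
  [set x | N x < r].

Definition tball mul (O : R -> 'M[R]_n) (N : 'rV[R]_n -> R) (r : R) y :
    set 'rV[R]_n :=
  \bigcup_(s in `[- r, r]) [set mul b (y *m O s) | b in hball N r].

End LieAlgebra.

(* Lebesgue measure on R^n, as the n-fold product of Lebesgue measure on R:
   the measure of A is the integral over the first coordinate of the measures
   of the sections of A. This is meaningful for Borel sets A only. *)
Fixpoint lebesgue_rV {R : realType} (n : nat) : set 'rV[R]_n -> \bar R :=
  match n with
  | 0%N => fun A => (\1_A 0)%:E
  | n'.+1 => fun A =>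
      (\int[lebesgue_measure]_x
         lebesgue_rV [set v : 'rV[R]_n' | A (row_mx (x%:M : 'M[R]_1) v)])%E
  end.

(* Main.v *)
Require Import Defs.
From HB Require Import structures.
From mathcomp Require Import all_boot all_order all_algebra.
From mathcomp Require Import all_classical all_reals all_analysis.
From mathcomp Require Import measurable_realfun ring lra.
Import Order.TTheory GRing.Theory Num.Theory.
Import numFieldNormedType.Exports.
Local Open Scope classical_set_scope.
Local Open Scope ring_scope.

(** Write B_r z for the translate of the ball B_r by z on the right, so that the
    twisted ball of radius r at y is the union of the B_r (O_s y), |s| <= r.

    Engulfing.  The group product is a polynomial map, hence bounded on the
    compact set where both norms are at most 1, and dilations are automorphisms;
    this gives a quasi-triangle inequality N(xy) <= k (N x + N y)
    (hnorm_quasi_triangle).  If two twisted balls of radius t meet, say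
    c (O_(s') y) = d (O_u x), then O_(s') y = (c^-1 d) (O_u x), and applying a
    further rotation, which is an automorphism preserving N, moves any
    b (O_s y) into a twisted ball at x of comparable radius (tball_engulfing).

    Doubling.  Among the points O_s x, |s| <= t, take a maximal family z_1 .. z_m
    whose balls B_t z_i are disjoint.  Those m balls lie in the twisted ball of
    radius t.  By maximality every O_s x, |s| <= t, is within a bounded multiple
    of t of some z_i; rotating by t or -t, the twisted ball of radius 2t is
    covered by 2m translates of a ball of radius c t.  Since all right translates
    of a ball have the same measure and since the measure of B_(ct) is at most
    C times that of B_t, the claim follows (tball_doubling).  If no maximal
    family exists, the twisted ball of radius t has infinite measure.

    So two facts about Lebesgue measure are needed.

    (a) An invertible linear map multiplies it by a constant (mu_linear).  With
    F a box, this follows by computing the measure of the pairs (x, y) with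
    xD + y in E and y in F in two ways with Tonelli's theorem, and neither
    determinants nor elementary matrices enter.  Applied to dilations, the
    constant cancels in the comparison of B_(ct) and B_t.

    (b) It is invariant under right translations of the group (mu_mul_right).
    The operators ad z generate a nilpotent family, so there is a basis in which
    all of them are strictly triangular (nil_family_triangular).  In the
    corresponding coordinates a right translation adds to the j-th coordinate a
    quantity that depends on the previous ones only, and such maps preserve
    Lebesgue measure by iterated integration (mu_unitriangular).  The change of
    basis is harmless by (a). *)

(** * Lebesgue measure on R^n: triangular and linear maps *)

Section LebesgueRV.
Context {R : realType}.

(** The generators of the product sigma-algebra of R^n.  With this choice a map
    into R^n is measurable as soon as its coordinates are, and adding a coordinate
    turns the product sigma-algebra of R * R^n into that of R^(n+1). *)
Definition coord_preimages (n : nat) : set (set 'rV[R]_n) :=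
  [set A | exists i (B : set (measurableTypeR R)),
     measurable B /\ A = [set v : 'rV[R]_n | B (v 0 i)]].

Local Notation mrV n := (g_sigma_algebraType (coord_preimages n)).

Definition box n (r : R) : set 'rV[R]_n := [set v | forall i, `|v 0 i| <= r].
Definition cons_rV n (p : R * 'rV[R]_n) : 'rV[R]_n.+1 :=
  row_mx (p.1%:M : 'M[R]_1) p.2.

Lemma cons_rV0 n (p : R * 'rV[R]_n) : cons_rV n p 0 0 = p.1.
Proof.
have -> : (0 : 'I_n.+1) = lshift n (0 : 'I_1) by exact: val_inj.
apply: etrans (row_mxEl _ _ _ _) _.
by rewrite mxE eqxx mulr1n.
Qed.

Lemma cons_rVS n (p : R * 'rV[R]_n) i : cons_rV n p 0 (lift 0 i) = p.2 0 i.
Proof.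
have -> : lift 0 i = rshift 1 i by exact: val_inj.
exact: row_mxEr.
Qed.

Lemma measurable_coord n i : measurable_fun [set: mrV n]
  ((fun v : 'rV[R]_n => v 0 i) : mrV n -> measurableTypeR R).
Proof.
move=> _ B mB; rewrite setTI.
by apply: sub_sigma_algebra; exists i, B.
Qed.

Lemma measurable_to_rV d (T : measurableType d) n (f : T -> 'rV[R]_n) :
  (forall i, measurable_fun setT
     ((fun x => f x 0 i) : T -> measurableTypeR R)) ->
  measurable_fun setT (f : T -> mrV n).
Proof.
move=> mf; apply: (@measurability _ _ _ (mrV n) setT f (coord_preimages n)) => //.
move=> _ [_ [i [B [mB ->]]]] <-.
by apply: (mf i).
Qed.

Lemma measurable_cons_rV n : measurable_fun setT
  (cons_rV n : (measurableTypeR R * mrV n)%type -> mrV n.+1).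
Proof.
apply: measurable_to_rV => i; case: (unliftP 0 i) => [j|] ->.
  under eq_fun do rewrite cons_rVS.
  exact: (measurableT_comp (measurable_coord n j) measurable_snd).
under eq_fun do rewrite cons_rV0.
exact: measurable_fst.
Qed.

Lemma measurable_box n r : measurable (box n r : set (mrV n)).
Proof.
rewrite (_ : box n r = \bigcap_(i in [set: 'I_n])
    [set v : 'rV[R]_n | `[- r, r]%classic (v 0 i)]).
  apply: fin_bigcap_measurable => // i _.
  rewrite -[X in measurable X]setTI.
  exact: (measurable_coord n i measurableT _ (measurable_itv `[- r, r])).
apply/seteqP; split=> v /= vr i.
  by move=> _; rewrite /= in_itv/= -ler_norml.
by have := vr i I; rewrite /= in_itv/= -ler_norml.
Qed.

Lemma lebesgue_rVS n (A : set 'rV[R]_n.+1) :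
  lebesgue_rV A = (\int[lebesgue_measure]_x
    lebesgue_rV [set v : 'rV[R]_n | A (cons_rV n (x, v))])%E.
Proof. by []. Qed.

(** The iterated integral is a measure because R^(n+1) carries the image of the
    product measure on R * R^n.  The induction carries along the measure of boxes,
    which provides the exhaustion needed for sigma-finiteness. *)
Lemma lebesgue_rV_measure_exists n :
  exists m : {sigma_finite_measure set (mrV n) -> \bar R},
    (forall A : set (mrV n), measurable A -> lebesgue_rV A = m A) /\
    (forall r, 0 <= r -> m (box n r) = ((2 * r) ^+ n)%:E).
Proof.
elim: n => [|n [m [mE mbox]]].
  exists (@dirac _ (mrV 0) (0 : 'rV[R]_0) R); split => [A mA|r r0] //=.
  by rewrite diracE mem_set ?expr0//= => -[].
pose p : set (mrV n.+1) -> \bar R :=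
  pushforward (lebesgue_measure \x m)%E
   (cons_rV n : (measurableTypeR R * mrV n)%type -> mrV n.+1).
have pE (A : set (mrV n.+1)) : measurable A -> lebesgue_rV A = p A.
  move=> mA; rewrite lebesgue_rVS /p /pushforward /product_measure1.
  apply: eq_integral => x _ /=.
  have E : [set v : 'rV[R]_n | A (cons_rV n (x, v))] =
    xsection ((cons_rV n : (measurableTypeR R * mrV n)%type -> mrV n.+1) @^-1` A) x.
    by apply/seteqP; split => v; rewrite /xsection /= ?inE// => ?; rewrite inE.
  rewrite E; apply: mE.
  apply: measurable_xsection.
  by rewrite -[X in measurable X]setTI; exact: measurable_cons_rV.
have pbox r : 0 <= r -> p (box n.+1 r) = ((2 * r) ^+ n.+1)%:E.
  move=> r0; rewrite /p /pushforward.
  have -> : cons_rV n @^-1` box n.+1 r = `[- r, r]%classic `*` box n r.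
    apply/seteqP; split => -[x v] /=.
      move=> vr; split; first by have := vr 0; rewrite cons_rV0 in_itv/= -ler_norml.
      by move=> i; have := vr (lift 0 i); rewrite cons_rVS.
    rewrite in_itv/= -ler_norml => -[xr vr] i.
    by case: (unliftP 0 i) => [j|] ->; rewrite ?cons_rVS ?cons_rV0.
  rewrite product_measure1E//; last exact: measurable_box.
  have := lebesgue_measure_itv `[- r, r]; rewrite /= lte_fin => ->.
  rewrite mbox//.
  have [rr|rr] := ltP.
    by rewrite -EFinB -EFinM exprS; congr (_ * _)%:E; ring.
  suff -> : r = 0 by rewrite mulr0 exprS mul0r mul0e.
  by apply/le_anti; rewrite r0 andbT; lra.
have sp : sigma_finite [set: mrV n.+1] p.
  exists (fun k => box n.+1 k%:R).
    apply/seteqP; split => // v _.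
    have [k vk] : exists k : nat, `|v| <= k%:R.
      by exists (Num.truncn `|v|).+1; apply/ltW; rewrite truncnS_gt.
    exists k => // i; apply: le_trans vk.
    rewrite [leRHS]/Num.norm/= mx_normrE.
    exact: (le_bigmax _ (fun ij => `|v ij.1 ij.2|) (0, i)).
  move=> k; split; first exact: measurable_box.
  by rewrite pbox// ltry.
have mr := @measurable_cons_rV n.
pose pm : {measure set (mrV n.+1) -> \bar R} :=
  measure_function_pushforward__canonical__measure_function_Measure
    (lebesgue_measure \x m)%E mr.
pose iss := Measure_isSigmaFinite.Build _ _ _ pm sp.
pose sm : {sigma_finite_measure set (mrV n.+1) -> \bar R} :=
  HB.pack p (Measure.class pm) iss.
exists sm.
by split.
Qed.

Definition mu n : {sigma_finite_measure set (mrV n) -> \bar R} :=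
  sval (cid (lebesgue_rV_measure_exists n)).

Lemma lebesgue_rVE n (A : set (mrV n)) :
  measurable A -> lebesgue_rV A = mu n A.
Proof. by move=> mA; rewrite /mu; case: cid => m [mE _] /=; exact: mE. Qed.

Lemma mu_box n r : 0 <= r -> mu n (box n r) = ((2 * r) ^+ n)%:E.
Proof. by move=> mA; rewrite /mu; case: cid => m [_ mE] /=; exact: mE. Qed.

Definition slice n (A : set 'rV[R]_n.+1) (x : R) : set 'rV[R]_n :=
  [set v | A (cons_rV n (x, v))].

Lemma sliceE n (A : set 'rV[R]_n.+1) x :
  slice n A x = xsection (cons_rV n @^-1` A) x.
Proof. by apply/seteqP; split => v; rewrite /xsection /= inE. Qed.

Lemma measurable_cons_preimage n (A : set (mrV n.+1)) : measurable A ->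
  measurable ((cons_rV n : (measurableTypeR R * mrV n)%type -> mrV n.+1) @^-1` A).
Proof.
by move=> mA; rewrite -[X in measurable X]setTI; exact: measurable_cons_rV.
Qed.

Lemma measurable_slice n (A : set (mrV n.+1)) x : measurable A ->
  measurable (slice n A x : set (mrV n)).
Proof.
move=> mA; rewrite sliceE; apply: (@measurable_xsection _ _ (measurableTypeR R) (mrV n)).
exact: measurable_cons_preimage.
Qed.

Lemma measurable_fun_slice n (A : set (mrV n.+1)) : measurable A ->
  measurable_fun [set: measurableTypeR R] (fun x => mu n (slice n A x)).
Proof.
move=> mA; under eq_fun do rewrite sliceE.
apply: (@measurable_fun_xsection _ _ (measurableTypeR R) (mrV n) _ (mu n)).
exact: measurable_cons_preimage.
Qed.

Lemma mu_slice n (A : set (mrV n.+1)) : measurable A ->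
  mu n.+1 A = (\int[lebesgue_measure]_x mu n (slice n A x))%E.
Proof.
move=> mA; rewrite -lebesgue_rVE// lebesgue_rVS.
apply: eq_integral => x _; rewrite -lebesgue_rVE//.
exact: measurable_slice.
Qed.

Lemma ge0_integral_shift (f : measurableTypeR R -> \bar R) (q : R) :
  measurable_fun setT f -> (forall x, 0 <= f x)%E ->
  (\int[lebesgue_measure]_x f (x + q)%R = \int[lebesgue_measure]_x f x)%E.
Proof.
move=> mf f0.
pose s : measurableTypeR R -> measurableTypeR R := fun x : R => x + q.
have ms : measurable_fun setT s by apply: measurable_funD.
transitivity (\int[pushforward (@lebesgue_measure R) s]_y f y)%E.
  by rewrite ge0_integral_pushforward// => x _.
apply: eq_measure_integral => A mA _; apply/esym.
apply: lebesgue_measure_unique => //= _ [[a b]] _ <-.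
rewrite /pushforward /=.
have -> : s @^-1` `]a, b]%classic = `]a - q, b - q]%classic.
  by apply/seteqP; split => x /=; rewrite !in_itv/= ltrBlDr lerBrDr /s.
have H (i : interval R) := lebesgue_measure_itv i.
rewrite (H `]a, b]) (H `]a - q, b - q])/= !lte_fin ltrD2r.
by case: ifP => // _; rewrite -!EFinB; congr _%:E; ring.
Qed.

Definition unitriangular n (f : 'rV[R]_n -> 'rV[R]_n) :=
  forall (y z : 'rV[R]_n) (j : 'I_n), (forall i : 'I_n, (i < j)%N -> y 0 i = z 0 i) ->
    f y 0 j - y 0 j = f z 0 j - z 0 j.

(** The first coordinate is translated by a constant q; once it is fixed, the
    remaining coordinates undergo a map of the same kind, so Fubini's theorem and
    the invariance of the measure on R under translations conclude. *)
Lemma mu_unitriangular n (f : 'rV[R]_n -> 'rV[R]_n) :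
  measurable_fun setT (f : mrV n -> mrV n) -> unitriangular n f ->
  forall A : set (mrV n), measurable A -> mu n (f @^-1` A) = mu n A.
Proof.
elim: n f => [|n ih] f mf tf A mA.
  congr (mu 0 _); apply/seteqP; split => v /=; by rewrite (thinmx0 v) (thinmx0 (f 0)).
have mfA : measurable (f @^-1` A : set (mrV n.+1)).
  by rewrite -[X in measurable X]setTI; exact: mf.
(* The increment of the first coordinate is the same at all points, so it may
   be read off at the origin. *)
pose q := f 0 0 0.
pose g x (v : 'rV[R]_n) : 'rV[R]_n := \row_j f (cons_rV n (x, v)) 0 (lift 0 j).
have fE x v : f (cons_rV n (x, v)) = cons_rV n (x + q, g x v).
  apply/rowP => j; case: (unliftP 0 j) => [i|] ->.
    by rewrite cons_rVS mxE.
  rewrite cons_rV0/=.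
  have := tf (cons_rV n (x, v)) 0 0 (fun i => ltac:(by [])).
  by rewrite cons_rV0 [in X in _ = X -> _]mxE subr0 => /eqP; rewrite subr_eq addrC => /eqP.
rewrite !mu_slice//.
rewrite -(@ge0_integral_shift (fun x => mu n (slice n A x)) q); last 2 first.
- exact: measurable_fun_slice.
- by move=> x; exact: measure_ge0.
apply: eq_integral => x _.
have -> : slice n (f @^-1` A) x = g x @^-1` (slice n A (x + q)).
  by apply/seteqP; split => v; rewrite /slice /= fE.
apply: ih; last exact: measurable_slice.
- apply: measurable_to_rV => j; under eq_fun do rewrite mxE.
  apply: (measurableT_comp (measurable_coord n.+1 (lift 0 j))).
  apply: (measurableT_comp mf).
  apply: (measurableT_comp (measurable_cons_rV n)).
  exact: measurable_fun_pair.
- move=> y z j yz; rewrite !mxE.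
  have := tf (cons_rV n (x, y)) (cons_rV n (x, z)) (lift 0 j).
  rewrite !cons_rVS; apply => i; case: (unliftP 0 i) => [k|] ->; last by rewrite !cons_rV0.
  by rewrite !cons_rVS; exact: yz.
Qed.

Lemma mu_translation n (a : 'rV[R]_n) (A : set (mrV n)) : measurable A ->
  mu n [set v | A (v + a)] = mu n A.
Proof.
move=> mA; apply: (mu_unitriangular n (fun v => v + a)) => //.
  apply: measurable_to_rV => j; under eq_fun do rewrite mxE.
  by apply: measurable_funD => //; exact: measurable_coord.
by move=> y z j _; rewrite !mxE; ring.
Qed.

Lemma measurable_mulmx d (T : measurableType d) n p (f : T -> 'rV[R]_n)
    (D : 'M[R]_(n, p)) :
  measurable_fun setT (f : T -> mrV n) ->
  measurable_fun setT ((fun x => f x *m D) : T -> mrV p).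
Proof.
move=> mf; apply: measurable_to_rV => j; under eq_fun do rewrite mxE.
apply: measurable_sum => k; apply: measurable_funM => //.
exact: (measurableT_comp (measurable_coord n k)).
Qed.

Lemma measurable_addrV d (T : measurableType d) n (f g : T -> 'rV[R]_n) :
  measurable_fun setT (f : T -> mrV n) ->
  measurable_fun setT (g : T -> mrV n) ->
  measurable_fun setT ((fun x => f x + g x) : T -> mrV n).
Proof.
move=> mf mg; apply: measurable_to_rV => j; under eq_fun do rewrite mxE.
by apply: measurable_funD; exact: (measurableT_comp (measurable_coord n j)).
Qed.

Lemma product_set_fubini n (S : set (mrV n * mrV n)) : measurable S ->
  (\int[mu n]_x mu n (xsection S x) = \int[mu n]_y mu n (ysection S y))%E.
Proof.
move=> mS; have := indic_fubini_tonelli (mu n) (mu n) mS.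
by rewrite indic_fubini_tonelli_FE// indic_fubini_tonelli_GE.
Qed.

(** Both sides measure the same set of pairs (x, y): integrating the set
    xD + y in E, y in F over x first gives the left-hand side; the substitution of
    y - xD for y followed by the integration over x gives the right-hand side.
    Only the invariance under additive translations is used. *)
Lemma mu_linear_box n (D : 'M[R]_n) (E : set (mrV n)) : D \in unitmx ->
  measurable E ->
  (mu n [set x | E (x *m D)] * mu n (box n 1) =
   mu n E * mu n [set x | box n 1 (x *m D)])%E.
Proof.
move=> uD mE; set F := box n 1.
have mF : measurable (F : set (mrV n)) by exact: measurable_box.
have mlin (G : set (mrV n)) : measurable G ->
    measurable ([set x : 'rV_n | G (x *m D)] : set (mrV n)).
  move=> mG; rewrite -[X in measurable X]setTI.
  exact: (@measurable_mulmx _ (mrV n) n n id D (@measurable_id _ (mrV n) setT)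
    measurableT G mG).
have mfst : measurable_fun setT ((fun p : mrV n * mrV n => p.1) : _ -> mrV n).
  exact: measurable_fst.
have msnd : measurable_fun setT ((fun p : mrV n * mrV n => p.2) : _ -> mrV n).
  exact: measurable_snd.
pose S1 : set (mrV n * mrV n) := [set p | E (p.1 *m D + p.2) /\ F p.2].
pose S2 : set (mrV n * mrV n) := [set p | E p.2 /\ F (p.1 *m (- D) + p.2)].
have mS1 : measurable S1.
  apply: measurableI.
    rewrite -[X in measurable X]setTI.
    by apply: (measurable_addrV _ _ _ _ _ (measurable_mulmx _ _ _ _ _ D mfst) msnd).
  by rewrite -[X in measurable X]setTI; exact: msnd.
have mS2 : measurable S2.
  apply: measurableI.
    by rewrite -[X in measurable X]setTI; exact: msnd.
  rewrite -[X in measurable X]setTI.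
  by apply: (measurable_addrV _ _ _ _ _ (measurable_mulmx _ _ _ _ _ (- D) mfst) msnd).
(* For y in F, the section is the preimage of E translated by - y D^-1. *)
transitivity (\int[mu n]_y mu n (ysection S1 y))%E.
  rewrite -integral_cst// [LHS]integral_mkcond.
  apply: eq_integral => y _; rewrite patchE.
  case: ifPn => yF.
    rewrite -(@mu_translation n (y *m invmx D)); last exact: mlin.
    congr (mu n _); apply/seteqP; split => x; rewrite /ysection /S1 /= ?inE/=.
      rewrite mulmxDl mulmxKV// => Ex; split => //; exact: set_mem.
    by rewrite mulmxDl mulmxKV// => -[].
  rewrite (_ : ysection S1 y = set0) ?measure0//.
  apply/seteqP; split => x //; rewrite /ysection /= inE => -[_ /= Fy].
  by move: yF; rewrite mem_set.
(* For y in E, the section is the preimage of - F = F translated by y D^-1. *)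
transitivity (\int[mu n]_y mu n (ysection S2 y))%E; last first.
  rewrite [RHS]muleC -integral_cst// [RHS]integral_mkcond.
  apply: eq_integral => y _; rewrite patchE.
  case: ifPn => yE.
    rewrite -[RHS](@mu_translation n (- (y *m invmx D))); last exact: mlin.
    have FN v : F (- v) <-> F v by split => Fv i; have := Fv i; rewrite mxE normrN.
    congr (mu n _); apply/seteqP; split => x; rewrite /ysection /S2 /= ?inE/=.
      by move=> -[_ /FN]; rewrite mulmxN opprD opprK mulmxBl mulmxKV.
    rewrite mulmxBl mulmxKV// => /FN Ex; split; first exact: set_mem.
    by move: Ex; rewrite mulmxN opprB addrC.
  rewrite (_ : ysection S2 y = set0) ?measure0//.
  apply/seteqP; split => x //; rewrite /ysection /= inE => -[/= Fy _].
  by move: yE; rewrite mem_set.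
(* For fixed x the two sections differ by the translation by xD. *)
rewrite -!product_set_fubini//; apply: eq_integral => x _.
rewrite -(@mu_translation n (x *m D) (xsection S2 x)); last exact: measurable_xsection.
congr (mu n _); apply/seteqP; split => y; rewrite /xsection /S1 /S2 /= !inE/=.
  by rewrite mulmxN addrCA addNr addr0 [y + _]addrC.
by rewrite mulmxN addrCA addNr addr0 [y + _]addrC.
Qed.

Lemma box_normP n (r : R) (v : 'rV[R]_n) : 0 <= r -> box n r v <-> `|v| <= r.
Proof.
move=> r0; rewrite [X in X <= _]/Num.norm/= mx_normrE; split.
  by move=> vr; apply: bigmax_le => // -[i j] _ /=; rewrite (ord1 i).
move=> vr i; apply: le_trans vr.
exact: (le_bigmax _ (fun ij => `|v ij.1 ij.2|) (0, i)).
Qed.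

Lemma mulmx_norm_bound n p (D : 'M[R]_(n, p)) :
  exists2 L : R, 0 < L & forall v : 'rV[R]_n, `|v *m D| <= L * `|v|.
Proof.
(* The summand 1 only serves to make the constant positive. *)
exists (1 + \sum_i \sum_j `|D i j|) => [|v].
  by rewrite ltr_pwDl// sumr_ge0// => i _; rewrite sumr_ge0.
apply/box_normP => [|j].
  by rewrite mulr_ge0// addr_ge0// sumr_ge0// => i _; rewrite sumr_ge0.
rewrite mxE (le_trans (ler_norm_sum _ _ _))// mulrDl mul1r.
rewrite -[leLHS]add0r lerD// mulr_suml ler_sum// => i _.
rewrite normrM mulrC ler_pM//.
  by rewrite (bigD1 j)//= lerDl sumr_ge0.
by have /box_normP : `|v| <= `|v| by []; exact.
Qed.

(** Taking the unit box for F in the preceding identity isolates the constant,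
    which is finite because the preimage of a box is bounded. *)
Lemma mu_linear n (D : 'M[R]_n) : D \in unitmx ->
  exists2 c : R, 0 <= c & forall E : set (mrV n), measurable E ->
    mu n [set x | E (x *m D)] = (c%:E * mu n E)%E.
Proof.
move=> uD.
have [L L0 DL] := mulmx_norm_bound n n (invmx D).
have mF : measurable ([set x : 'rV_n | box n 1 (x *m D)] : set (mrV n)).
  rewrite -[X in measurable X]setTI.
  apply: (@measurable_mulmx _ (mrV n) n n id D (@measurable_id _ (mrV n) setT) measurableT).
  exact: measurable_box.
have fF : mu n [set x | box n 1 (x *m D)] \is a fin_num.
  rewrite ge0_fin_numE//; apply: (@le_lt_trans _ _ (mu n (box n L))).
    apply: le_measure; rewrite ?inE//; first exact: measurable_box.
    move=> x /= /(box_normP _ _ _ ler01) xD; apply/box_normP; first exact: ltW.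
    rewrite -[x](mulmxK uD) (le_trans (DL _))//.
    by rewrite -[leRHS]mulr1 ler_pM2l.
  by rewrite mu_box ?ltry// ltW.
exists (fine (mu n [set x | box n 1 (x *m D)]) / 2 ^+ n).
  by rewrite divr_ge0// fine_ge0.
move=> E mE; have := mu_linear_box n D E uD mE.
rewrite mu_box// mulr1 -{1}(fineK fF) => H.
have n2 : (2 ^+ n : R) != 0 by rewrite expf_neq0.
rewrite -[LHS]mule1 -[1%E](_ : ((2 ^+ n)%:E * ((2 ^+ n)^-1)%:E = 1)%E); last first.
  by rewrite -EFinM mulfV.
by rewrite muleA H EFinM -muleA muleC.
Qed.

(** An open set is the union of the boxes with rational centre and radius that it
    contains. *)
Lemma open_measurable_rV n (U : set 'rV[R]_n) : open U -> measurable (U : set (mrV n)).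
Proof.
move=> oU.
pose Q := ('rV[rat]_n * rat)%type.
pose B (p : Q) : set 'rV[R]_n := [set v | box n (ratr p.2) (v - map_mx ratr p.1)].
have mB p : measurable (B p : set (mrV n)).
  have := measurable_box n (ratr p.2).
  move=> mb; rewrite -[X in measurable X]setTI.
  exact: (@measurable_addrV _ (mrV n) n id (fun=> - map_mx ratr p.1)
    (@measurable_id _ (mrV n) setT) (@measurable_cst _ _ (mrV n) (mrV n) _ _)
    measurableT _ mb).
rewrite (_ : U = \bigcup_(p in [set: Q]) (if `[< B p `<=` U >] then B p else set0)).
  apply: countable_bigcupT_measurable => [|p]; last by case: ifP.
  exact: (@countableP _ [set: ('rV[rat]_n * rat)%type]).
apply/seteqP; split => [v Uv|v [p _]]; last by case: asboolP => // BU /BU.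
have /nbhs_ballP[e /= e0 eU] : nbhs v U by exact: open_nbhs_nbhs.
have [r] := rat_in_itvoo (divr_gt0 e0 (ltr0n _ 2) : 0 < e / 2).
rewrite in_itv/= => /andP[r0 re].
have qP i : {q : rat | ratr q \in `](v 0 i - ratr r), (v 0 i + ratr r)[}.
  by apply/cid/rat_in_itvoo; lra.
pose q : 'rV[rat]_n := \row_i sval (qP i).
have Bv : B (q, r) v.
  move=> i; rewrite !mxE; case: (qP i) => x /=; rewrite in_itv/= => /andP[? ?].
  by rewrite ler_norml; apply/andP; split; lra.
exists (q, r) => //; rewrite asboolT// => w Bw.
apply: eU; rewrite -ball_normE/=.
apply: (@le_lt_trans _ _ (ratr r + ratr r)); last by lra.
rewrite -(subrK (map_mx ratr q) v) -addrA (le_trans (ler_normD _ _))// lerD//.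
  by apply/box_normP => //; exact: ltW.
by rewrite distrC; apply/box_normP => //; exact: ltW.
Qed.

End LebesgueRV.

Local Notation mrV n := (g_sigma_algebraType (coord_preimages n)).

(** * Simultaneous triangularization of nil families *)

Section Triangularization.
Context {F : fieldType}.

Definition prodmx n (s : seq 'M[F]_n) : 'M[F]_n := foldr mulmx 1%:M s.

Definition nil_family n (S : 'M[F]_n -> Prop) m : Prop :=
  forall s : seq 'M[F]_n, size s = m -> (forall M, M \in s -> S M) ->
    prodmx n s = 0.

(** A nonzero column of a nonzero product of maximal length is killed by every
    member of the family. *)
Lemma nil_family_common_kernel n (S : 'M[F]_n.+1 -> Prop) m :
  nil_family n.+1 S m ->
  exists2 u : 'cV[F]_n.+1, u != 0 & forall M, S M -> M *m u = 0.
Proof.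
elim: m => [|m ih] nS.
  have /(congr1 (fun M : 'M[F]_n.+1 => M 0 0)) := nS [::] erefl (fun M => ltac:(by [])).
  by rewrite !mxE => /eqP; rewrite eqxx oner_eq0.
have [/ih//|] := EM (nil_family n.+1 S m).
move=> /existsNP[s /not_implyP[sm /not_implyP[sS /eqP s0]]].
have [i ui] : exists i, col i (prodmx n.+1 s) != 0.
  apply/existsP; apply: contraNT s0 => /existsPn s0; apply/eqP/matrixP => i j.
  by have /eqP/colP/(_ i) := negbNE (s0 j); rewrite !mxE.
exists (col i (prodmx n.+1 s)) => // M SM.
rewrite colE mulmxA (_ : M *m _ = prodmx n.+1 (M :: s)) // nS ?/= ?sm//.
  by rewrite mul0mx.
by move=> N; rewrite inE => /orP[/eqP->//|]; exact: sS.
Qed.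

Lemma unitmx_first_column n (u : 'cV[F]_n.+1) : u != 0 ->
  exists2 Q : 'M[F]_(1 + n), Q \in unitmx &
    exists c : F, lsubmx Q = c *: u.
Proof.
move=> u0; exists (col_ebase u); first exact: col_ebase_unit.
have ru : \rank u = 1%N.
  by apply/eqP; rewrite eqn_leq rank_leq_col lt0n mxrank_eq0.
have rb := row_ebase_unit u.
have /(congr1 (mulmx^~ (invmx (row_ebase u)))) := mulmx_ebase u.
rewrite mulmxK// ru => H.
exists (invmx (row_ebase u) 0 0).
apply/colP => i; have := congr1 (fun v : 'cV[F]_n.+1 => v i 0) H.
rewrite /= [RHS]mxE big_ord1 => E.
rewrite [in RHS]mxE [RHS]mulrC -E !mxE (bigD1 (0 : 'I_n.+1))//= !mxE/=.
rewrite mulr1 big1 ?addr0 => [|j j0].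
  by congr (col_ebase u _ _); exact: val_inj.
by rewrite mxE/= -[(j == 0 :> nat)]/(j == 0) (negPf j0) mulr0.
Qed.

(** The associative case of Engel's theorem.  Taking a common kernel vector as first
    basis vector, the first column of every matrix of the family vanishes, and the
    lower right blocks again form a nil family, in dimension one less. *)
Lemma nil_family_triangular n (S : 'M[F]_n -> Prop) m : nil_family n S m ->
  exists2 Q : 'M[F]_n, Q \in unitmx &
    forall M, S M -> forall i j : 'I_n, (j <= i)%N ->
      (invmx Q *m M *m Q) i j = 0.
Proof.
elim: n S => [|n ih] S nS; first by exists 1%:M; rewrite ?unitmx1// => M _ [].
have [u u0 Su] := nil_family_common_kernel _ _ _ nS.
have [Q uQ [c Qu]] := unitmx_first_column _ _ u0.
have QE M : S M -> invmx Q *m M *m Q = block_mx 0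
    (ursubmx (invmx Q *m M *m Q)) 0 (drsubmx (invmx Q *m M *m Q)).
  move=> SM; rewrite -[LHS](@submxK _ 1 n 1 n).
  have L : lsubmx (invmx Q *m M *m Q) = 0.
    by rewrite -mulmx_lsub Qu -scalemxAr -mulmxA Su// mulmx0 scaler0.
  congr (block_mx _ _ _ _); apply/matrixP => i j.
    by have := congr1 (fun A : 'M[F]_(_, _) => A (lshift n i) j) L; rewrite !mxE.
  by have := congr1 (fun A : 'M[F]_(_, _) => A (rshift 1 i) j) L; rewrite !mxE.
pose S' (N : 'M[F]_n) := exists2 M, S M & N = drsubmx (invmx Q *m M *m Q).
have [Q' uQ' Q'P] : exists2 Q : 'M[F]_n, Q \in unitmx &
    forall M, S' M -> forall i j : 'I_n, (j <= i)%N ->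
      (invmx Q *m M *m Q) i j = 0.
  apply: ih => s sm sS.
  have {sm} : exists2 t : seq 'M[F]_(1 + n), size t = m & 
      (forall M, M \in t -> S M) /\
      exists r, invmx Q *m prodmx _ t *m Q = block_mx (size t == 0)%:R%:M r 0 (prodmx n s).
    move: m {nS} sm; elim: s sS => [|N s ihs] sS [|m] //= sm.
      exists [::] => //; split => //; exists 0.
      by rewrite mulmx1 mulVmx// -scalar_mx_block.
    have [|t tm [tS [r tE]]] := ihs _ m (succn_inj sm).
      by move=> M Ms; apply: sS; rewrite inE Ms orbT.
    have [M SM NE] := sS N (mem_head _ _).
    exists (M :: t); first by rewrite /= tm.
    split; first by move=> ?; rewrite inE => /orP[/eqP->//|]; exact: tS.
    have -> : invmx Q *m prodmx _ (M :: t) *m Q =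
      (invmx Q *m M *m Q) *m (invmx Q *m prodmx _ t *m Q).
      by rewrite /= !mulmxA mulmxK.
    rewrite (QE _ SM) tE -NE mulmx_block !mul0mx !mulmx0 !addr0 !add0r.
    rewrite (_ : 0%:R%:M = 0) ?add0r; last by rewrite -scalemx1 scale0r.
    by eexists.
  move=> [t tm [tS [r]]]; rewrite (nS t tm tS) mulmx0 mul0mx -[0]block_mx0.
  by move=> /eq_block_mx[_ _ _ <-].
set B : 'M[F]_(1 + n) := block_mx 1%:M 0 0 Q'.
have uB : B \in unitmx by rewrite unitmxE det_ublock det1 mul1r -unitmxE.
have iB : block_mx 1%:M 0 0 (invmx Q') *m B = 1%:M.
  by rewrite mulmx_block !mulmx0 !mul0mx !mul1mx mulVmx// !addr0 add0r -scalar_mx_block.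
have uQB : Q *m B \in unitmx by rewrite unitmx_mul uQ uB.
have iQB : invmx (Q *m B) = block_mx 1%:M 0 0 (invmx Q') *m invmx Q.
  have E : block_mx 1%:M 0 0 (invmx Q') *m invmx Q *m (Q *m B) = 1%:M.
    by rewrite -mulmxA [invmx Q *m _]mulmxA mulVmx// mul1mx.
  by rewrite -[LHS]mul1mx -E -mulmxA mulmxV// mulmx1.
exists (Q *m B) => // M SM i j ji.
have -> : invmx (Q *m B) *m M *m (Q *m B) =
  block_mx 0 (ursubmx (invmx Q *m M *m Q) *m Q') 0
    (invmx Q' *m drsubmx (invmx Q *m M *m Q) *m Q').
  rewrite iQB mulmxA -!(mulmxA _ _ M) -!(mulmxA _ _ Q) [invmx Q *m _]mulmxA.
  rewrite [in LHS]QE// !mulmx_block.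
  by rewrite ?(mulmx0, mul0mx, mul1mx, addr0, add0r).
move: (i : 'I_(1 + n)) (j : 'I_(1 + n)) ji => {}i {}j.
case: (split_ordP i) => {}i ->; case: (split_ordP j) => {}j -> ji.
- by apply: etrans (block_mxEul _ _ _ _ _ _) _; rewrite mxE.
- by move: ji; rewrite /= ord1.
- by apply: etrans (block_mxEdl _ _ _ _ _ _) _; rewrite mxE.
apply: etrans (block_mxEdr _ _ _ _ _ _) _; apply: Q'P; first by exists M.
by move: ji; rewrite /= leq_add2l.
Qed.

End Triangularization.

(** * The Campbell-Hausdorff product *)

Lemma continuous_measurable_rV (R : realType) n p (f : 'rV[R]_n -> 'rV[R]_p) :
  continuous f -> measurable_fun setT (f : mrV n -> mrV p).
Proof.
move=> cf; apply: measurable_to_rV => i.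
apply: (measurability _ (RGenOInfty.measurableE R)).
move=> /= _ [_ [a ->]] <-; rewrite setTI.
apply: open_measurable_rV.
have ci : continuous (fun x => f x 0 i).
  by move=> x; apply: (@continuous_comp _ _ _ f (fun M => M 0 i));
     [exact: cf|exact: coord_continuous].
apply: (@open_comp _ _ (fun x => f x 0 i) `]a, +oo[%classic) => [x _|]; first exact: ci.
exact: interval_open.
Qed.

Lemma continuous_sumV (R : realType) n (T : topologicalType) I (r : seq I)
    (P : pred I) (F : I -> T -> 'rV[R]_n) :
  (forall i, P i -> continuous (F i)) ->
  continuous (fun t => \sum_(i <- r | P i) F i t).
Proof. by move=> cF; apply: continuous_big => //; exact: add_continuous. Qed.

Lemma continuous_mulmx (R : realType) n p (T : topologicalType)
    (f : T -> 'rV[R]_n) (M : 'M[R]_(n, p)) :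
  continuous f -> continuous (fun t => f t *m M).
Proof.
move=> cf.
have E t : f t *m M = \sum_i f t 0 i *: row i M.
  rewrite {1}[f t]row_sum_delta mulmx_suml; apply: eq_bigr => i _.
  by rewrite -scalemxAl -rowE.
rewrite (funext E); apply: continuous_sumV => i _ t; apply: cvgZr_tmp.
exact: (continuous_comp (cf t) (@coord_continuous _ 1 n 0 i (f t))).
Qed.

Section NilpotentGroup.
Context {R : realType} {n : nat}.
Variables (br mul : 'rV[R]_n -> 'rV[R]_n -> 'rV[R]_n).
Hypothesis hG : is_nilpotent_lie_group br mul.

Let hbr : is_lie_bracket br := nlg_bracket hG.

Lemma br_mx x (z : 'rV[R]_n) : br z x = \sum_j x 0 j *: br z (delta_mx 0 j).
Proof.
have br0 : br z 0 = 0.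
  by have := br_linearr hbr (-1) 0 0 z; rewrite scaler0 addr0 scaleN1r addNr.
rewrite {1}(row_sum_delta x); apply: (big_ind2 (fun a b => br z a = b)) => //.
- move=> a a' b b' <- <-.
  by rewrite -[a in LHS]scale1r br_linearr// scale1r.
- by move=> i _; rewrite -[_ *: _ in LHS]addr0 br_linearr// br0 addr0.
Qed.

Lemma br_anti x y : br x y = - br y x.
Proof.
have brDl a b c : br (a + b) c = br a c + br b c.
  by rewrite -{1}[a]scale1r br_linearl// scale1r.
have brDr a b c : br c (a + b) = br c a + br c b.
  by rewrite -{1}[a]scale1r br_linearr// scale1r.
have := br_alt hbr (x + y).
rewrite brDl !brDr !(br_alt hbr) add0r addr0 => /eqP.
by rewrite addr_eq0 => /eqP.
Qed.

Lemma br0r z : br z 0 = 0.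
Proof. by rewrite br_mx big1// => j _; rewrite mxE scale0r. Qed.

Lemma lower_central_sub m i : lower_central br m `<=` [set 0] ->
  lower_central br (m + i) `<=` [set 0].
Proof.
move=> m0; elim: i => [|i ih]; first by rewrite addn0.
rewrite addnS => v /= /(_ 0%VS) => H.
apply/eqP; rewrite -memv0; apply: H => _ [[a b] /= [_ /ih ->] <-].
by rewrite /= br0r mem0v.
Qed.

Lemma br_lower_central m z v : lower_central br m v ->
  lower_central br m.+1 (br z v).
Proof. by move=> mv V; apply; exists (z, v). Qed.

Lemma nested_bracket_lower_central z s :
  lower_central br (size s) (nested_bracket br (z :: s)).
Proof.
elim: s z => [//|y s ih] z.
exact: br_lower_central (ih y).
Qed.

(** The Campbell-Hausdorff word without its two arguments: substituting x for true
    and y for false recovers ch_word.  Facts about the bracket of a word are then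
    proved by induction on a fixed sequence of booleans. *)
Definition letters d k (p : {ffun 'I_k -> 'I_d.+1 * 'I_d.+1}) : seq bool :=
  flatten [seq nseq (p i).1 true ++ nseq (p i).2 false | i <- enum 'I_k].

Definition letter (x y : 'rV[R]_n) (b : bool) := if b then x else y.

Lemma ch_wordE d k (p : {ffun 'I_k -> 'I_d.+1 * 'I_d.+1}) x y :
  ch_word p x y = map (letter x y) (letters d k p).
Proof.
rewrite /ch_word /letters map_flatten -map_comp; congr flatten.
by apply: eq_map => i /=; rewrite map_cat !map_nseq.
Qed.

Lemma size_letters d k (p : {ffun 'I_k -> 'I_d.+1 * 'I_d.+1}) :
  size (letters d k p) = (\sum_i ((p i).1 + (p i).2))%N.
Proof.
rewrite size_flatten /shape -map_comp sumnE big_map big_enum /=.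
by apply: eq_bigr => i _; rewrite size_cat !size_nseq.
Qed.

Definition ch_coef d k (p : {ffun 'I_k -> 'I_d.+1 * 'I_d.+1}) : R :=
  (d%:R * \prod_i (((p i).1)`!%:R * ((p i).2)`!%:R))^-1.

Lemma ch_termE x y d : ch_term br x y d =
  \sum_(1 <= k < d.+1) ((-1) ^+ k.-1 / k%:R) *:
    \sum_(p : {ffun 'I_k -> 'I_d.+1 * 'I_d.+1} |
           [forall i, (0 < (p i).1 + (p i).2)%N] && (size (letters d k p) == d))
      ch_coef d k p *: nested_bracket br (map (letter x y) (letters d k p)).
Proof.
apply: eq_bigr => k _; congr (_ *: _); apply: eq_big => p.
  by rewrite size_letters.
by rewrite ch_wordE.
Qed.

(** A word of length greater than the nilpotency class has a vanishing bracket, and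
    the term of degree d only involves words of length d. *)
Lemma mul_ch_sum : exists m, forall x y, mul x y = \sum_(0 <= d < m) ch_term br x y d.
Proof.
have [m m0] := nlg_nilpotent hG.
exists m.+1 => x y; rewrite (nlg_mulE hG).
apply: lim_near_cst => //; exists m.+1 => // k /= mk.
rewrite /series /= (big_cat_nat _ (n := m.+1))//= [X in _ + X]big_nat_cond.
rewrite [X in _ + X]big1 ?addr0// => d /andP[/andP[md _] _].
rewrite ch_termE big1// => j _; rewrite big1 ?scaler0// => p /andP[_ /eqP sp].
have : size (map (letter x y) (letters d j p)) = d by rewrite size_map.
case: (map _ _) => [|z s] sd; first by rewrite -sd in md.
suff -> : nested_bracket br (z :: s) = 0 by rewrite scaler0.
apply: (lower_central_sub m (size s - m) m0).
rewrite subnKC; first exact: (nested_bracket_lower_central z s).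
by rewrite -ltnS -[(size s).+1]/(size (z :: s)) sd.
Qed.

Lemma mul_lie_aut M x y : lie_aut br M -> mul (x *m M) (y *m M) = mul x y *m M.
Proof.
move=> [uM brM]; have [m mE] := mul_ch_sum.
have nM s : nested_bracket br (map (mulmx^~ M) s) = nested_bracket br s *m M.
  elim: s => [|z [|t s] ih] /=; [by rewrite mul0mx|by []|].
  by rewrite brM -ih.
rewrite !mE mulmx_suml; apply: eq_bigr => d _.
rewrite !ch_termE mulmx_suml; apply: eq_bigr => k _.
rewrite -scalemxAl mulmx_suml; congr (_ *: _); apply: eq_bigr => p _.
rewrite -scalemxAl -nM -map_comp; congr (_ *: nested_bracket _ _).
by apply: eq_map => -[].
Qed.

(** Expanding both arguments in the standard basis turns the bracket into a finite
    sum of products of coordinates. *)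
Lemma continuous_br (T : topologicalType) (f g : T -> 'rV[R]_n) :
  continuous f -> continuous g -> continuous (fun t => br (f t) (g t)).
Proof.
move=> cf cg; pose e i : 'rV[R]_n := delta_mx 0 i.
have E t : br (f t) (g t) =
  \sum_j \sum_i (g t 0 j * f t 0 i) *: - br (e j) (e i).
  rewrite br_mx; apply: eq_bigr => j _.
  rewrite br_anti br_mx -sumrN scaler_sumr; apply: eq_bigr => i _.
  by rewrite -scalerN scalerA.
rewrite (funext E); apply: continuous_sumV => j _; apply: continuous_sumV => i _ t.
apply: cvgZr_tmp; apply: cvgM.
- exact: (continuous_comp (cg t) (@coord_continuous _ 1 n 0 j (g t))).
- exact: (continuous_comp (cf t) (@coord_continuous _ 1 n 0 i (f t))).
Qed.

Lemma continuous_mul (T : topologicalType) (f g : T -> 'rV[R]_n) :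
  continuous f -> continuous g -> continuous (fun t => mul (f t) (g t)).
Proof.
move=> cf cg; have [m mE] := mul_ch_sum.
rewrite (funext (fun t => mE (f t) (g t))).
apply: continuous_sumV => d _; rewrite (funext (fun t => ch_termE (f t) (g t) d)).
apply: continuous_sumV => k _ t; apply: cvgZl_tmp; move: t.
apply: continuous_sumV => p _ t; apply: cvgZl_tmp; move: t.
elim: (letters d k p) => [|b [|b' s] ih] /=.
- by move=> t; exact: cvg_cst.
- by case: b.
- by apply: continuous_br => //; case: b.
Qed.

Definition ad_mx z : 'M[R]_n := \matrix_(i, j) br z (delta_mx 0 i) 0 j.

Lemma ad_mxE z y : y *m ad_mx z = br z y.
Proof.
rewrite br_mx; apply/rowP => j; rewrite !mxE summxE.
by apply: eq_bigr => i _; rewrite !mxE.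
Qed.

(** By nilpotency, an m-fold product of adjoint operators maps everything into the
    m-th term of the lower central series, which is zero. *)
Lemma ad_triangular : exists2 Q : 'M[R]_n, Q \in unitmx &
  forall z (i j : 'I_n), (j <= i)%N -> (invmx Q *m ad_mx z *m Q) i j = 0.
Proof.
have [m m0] := nlg_nilpotent hG.
have [|Q uQ QP] := @nil_family_triangular R n (fun M => exists z, M = ad_mx z) m.
  move=> s sm sS; apply/row_matrixP => i; rewrite rowE row0.
  move: (delta_mx _ _) => v.
  suff H k : lower_central br k v -> lower_central br (k + size s) (v *m prodmx n s).
    by apply: m0; rewrite -sm; exact: (H 0%N).
  elim: s sS {sm} v k => [|M s ih] sS v k vk /=; first by rewrite addn0 mulmx1.
  have [z ->] := sS M (mem_head _ _).
  rewrite addnS -addSn mulmxA; apply: ih.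
    by move=> N Ns; apply: sS; rewrite inE Ns orbT.
  by rewrite ad_mxE; exact: br_lower_central.
exists Q => // z; apply: QP; by exists z.
Qed.

Let rowB (u v : 'rV[R]_n) i : (u - v) 0 i = u 0 i - v 0 i.
Proof. by rewrite !mxE. Qed.

Definition agree_coords (Q : 'M[R]_n) (k : nat) (y z : 'rV[R]_n) :=
  forall i : 'I_n, (i < k)%N -> (y *m Q) 0 i = (z *m Q) 0 i.

Lemma agree_sum Q k I (r : seq I) (P : pred I) (f g : I -> 'rV[R]_n) :
  (forall i, P i -> agree_coords Q k (f i) (g i)) ->
  agree_coords Q k (\sum_(i <- r | P i) f i) (\sum_(i <- r | P i) g i).
Proof.
move=> fg; apply: (big_ind2 (agree_coords Q k)) => // a b c d ab cd i ik.
by rewrite !mulmxDl mxE [in RHS]mxE ab// cd.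
Qed.

Lemma agreeZ Q k c y z : agree_coords Q k y z -> agree_coords Q k (c *: y) (c *: z).
Proof. by move=> yz i ik; rewrite -!scalemxAl mxE [in RHS]mxE yz. Qed.

Lemma agreeB Q k a b c d : agree_coords Q k a b -> agree_coords Q k c d ->
  agree_coords Q k (a - c) (b - d).
Proof.
by move=> ab cd i ik; rewrite !mulmxBl !rowB ab// cd.
Qed.

(** Strict triangularity gains one coordinate in the second argument, hence in both
    by antisymmetry. *)
Lemma agree_br Q k : Q \in unitmx ->
  (forall z (i j : 'I_n), (j <= i)%N -> (invmx Q *m ad_mx z *m Q) i j = 0) ->
  forall a b c d, agree_coords Q k a b -> agree_coords Q k c d ->
    agree_coords Q k.+1 (br a c) (br b d).
Proof.
move=> uQ QT.
have step z c d : agree_coords Q k c d -> agree_coords Q k.+1 (br z c) (br z d).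
  move=> cd j jk.
  have E v : br z v *m Q = (v *m Q) *m (invmx Q *m ad_mx z *m Q).
    by rewrite -ad_mxE !mulmxA mulmxK.
  rewrite !E !mxE; apply: eq_bigr => i _.
  have [ij|ji] := ltnP i j; last by rewrite QT// !mulr0.
  by rewrite cd//; exact: leq_trans ij _.
move=> a b c d ab cd i ik; rewrite (step a c d)//.
by rewrite br_anti [br b d]br_anti !mulNmx mxE [in RHS]mxE (step d a b).
Qed.

(** Words of length one are excluded, since no bracket is taken there and no
    coordinate is gained. *)
Lemma agree_nested Q k : Q \in unitmx ->
  (forall z (i j : 'I_n), (j <= i)%N -> (invmx Q *m ad_mx z *m Q) i j = 0) ->
  forall (c c' : bool -> 'rV[R]_n), (forall b, agree_coords Q k (c b) (c' b)) ->
  forall s, (size s != 1)%N ->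
  agree_coords Q k.+1 (nested_bracket br (map c s)) (nested_bracket br (map c' s)).
Proof.
move=> uQ QT c c' cc.
have W s : agree_coords Q k (nested_bracket br (map c s)) (nested_bracket br (map c' s)).
  elim: s => [|b [|b' s] ih] //=.
  by move=> i ik; apply: (agree_br Q k uQ QT) => //; exact: ltnW.
case=> [|b [|b' s]] // _.
by apply: (agree_br Q k uQ QT) => //; exact: (W (b' :: s)).
Qed.

(** As y = y * 0, the increment y * a - y is the sum of the differences between the
    Campbell-Hausdorff terms of (y, a) and of (y, 0).  Words of length one
    contribute a quantity independent of y, and longer ones gain a coordinate. *)
Lemma mul_triangular : exists2 Q : 'M[R]_n, Q \in unitmx &
  forall a, unitriangular n (fun y => mul (y *m invmx Q) a *m Q).
Proof.
have [Q uQ QT] := ad_triangular; exists Q => // a y z j yz.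
have [m mE] := mul_ch_sum.
have yzQ : agree_coords Q j (y *m invmx Q) (z *m invmx Q).
  by move=> i ij; rewrite !mulmxKV//; exact: yz.
suff : agree_coords Q j.+1 (mul (y *m invmx Q) a - mul (y *m invmx Q) 0)
                    (mul (z *m invmx Q) a - mul (z *m invmx Q) 0).
  move=> /(_ j (leqnn _)).
  by rewrite !(nlg_mul0r hG) !mulmxBl !mulmxKV// !rowB.
rewrite !mE -!sumrB; apply: agree_sum => d _.
rewrite !ch_termE -!sumrB; apply: agree_sum => k _.
rewrite -!scalerBr; apply: agreeZ.
rewrite -!sumrB; apply: agree_sum => p _.
rewrite -!scalerBr; apply: agreeZ.
have [s1|s1] := eqVneq (size (letters d k p)) 1%N.
  case: (letters d k p) s1 => [|[] [|]] //= _.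
  by rewrite !subrr.
have cc b u : agree_coords Q j (letter (y *m invmx Q) u b) (letter (z *m invmx Q) u b).
  by case: b.
by apply: agreeB; apply: agree_nested.
Qed.

(** In the triangular coordinates the translation preserves the measure, and the two
    changes of coordinates multiply it by inverse factors. *)
Lemma mu_mul_right a (E : set (mrV n)) : measurable E ->
  mu n [set y | E (mul y a)] = mu n E.
Proof.
move=> mE; have [Q uQ QT] := mul_triangular.
pose f y := mul (y *m invmx Q) a *m Q.
have mulmx_cont (M : 'M[R]_n) : continuous (fun y : 'rV[R]_n => y *m M).
  by apply: continuous_mulmx => y.
have cf : continuous f.
  have c : continuous (fun y : 'rV[R]_n => mul (y *m invmx Q) a).
    apply: continuous_mul; [exact: mulmx_cont|exact: cst_continuous].
  by move=> y; exact: (continuous_comp (c y) (mulmx_cont Q _)).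
have mf := continuous_measurable_rV R n n f cf.
have [c _ cE] := mu_linear n Q uQ.
have mE' : measurable ([set y : 'rV[R]_n | E (y *m invmx Q)] : set (mrV n)).
  have := continuous_measurable_rV R n n _ (mulmx_cont (invmx Q)) measurableT E mE.
  by rewrite setTI.
have mfE : measurable (f @^-1` [set y : 'rV[R]_n | E (y *m invmx Q)] : set (mrV n)).
  by rewrite -[X in measurable X]setTI; exact: mf.
have -> : [set y | E (mul y a)] =
    [set y | (f @^-1` [set y : 'rV[R]_n | E (y *m invmx Q)]) (y *m Q)].
  by apply/seteqP; split => y; rewrite /f /= !mulmxK.
rewrite cE// mu_unitriangular//; last exact: QT.
rewrite -cE//; congr (mu n _).
by apply/seteqP; split => y /=; rewrite mulmxK.
Qed.

End NilpotentGroup.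

(** * Dilations and homogeneous norms *)

Section Dilations.
Context {R : realType} {n : nat}.

Lemma mulmx_diag_sum (V W : 'M[R]_n) (d : 'rV[R]_n) :
  V *m diag_mx d *m W = \sum_i d 0 i *: (col i V *m row i W).
Proof.
rewrite diag_mx_sum_delta mulmx_sumr mulmx_suml; apply: eq_bigr => i _.
rewrite -scalemxAr -scalemxAl; congr (_ *: _).
by rewrite colE rowE mulmxA -[X in _ = X *m _]mulmxA mul_delta_mx.
Qed.

(** The partial sums of the exponential series are combinations of fixed rank-one
    matrices, the coefficients being partial sums of scalar exponential series. *)
Lemma expmx_diag (P : 'M[R]_n) (d : 'rV[R]_n) : P \in unitmx ->
  expmx (invmx P *m diag_mx d *m P) = invmx P *m diag_mx (map_mx expR d) *m P.
Proof.
move=> uP; have pw k : (invmx P *m diag_mx d *m P) ^+ k =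
    invmx P *m diag_mx (map_mx (fun a => a ^+ k) d) *m P.
  elim: k => [|k ih].
    rewrite expr0 (_ : map_mx _ d = const_mx 1); last by apply/rowP => i; rewrite !mxE expr0.
    by rewrite diag_const_mx mulmx1 mulVmx.
  rewrite exprS ih -mulmxE !mulmxA mulmxK// -!mulmxA.
  congr (_ *m _); rewrite mulmxA mulmx_diag; congr (diag_mx _ *m _).
  by apply/rowP => i; rewrite !mxE exprS.
rewrite /expmx; apply: cvg_lim => //.
have E k : series (fun k => k`!%:R^-1 *: (invmx P *m diag_mx d *m P) ^+ k) k =
   \sum_i series (exp_coeff (d 0 i)) k *: (col i (invmx P) *m row i P).
  rewrite /series /=; under [RHS]eq_bigr do rewrite scaler_suml.
  rewrite exchange_big/=; apply: eq_bigr => j _.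
  rewrite pw mulmx_diag_sum scaler_sumr; apply: eq_bigr => i _.
  by rewrite scalerA mxE /exp_coeff/= mulrC.
rewrite (funext E) mulmx_diag_sum; apply: cvg_big; first exact: add_continuous.
move=> i _; apply: cvgZr_tmp; rewrite mxE; exact: is_cvg_series_exp_coeff.
Qed.

Variables (br mul : 'rV[R]_n -> 'rV[R]_n -> 'rV[R]_n) (A : 'M[R]_n).
Hypothesis hA : is_dilation_generator br A.

Lemma dilation_diag : exists P : 'M[R]_n, exists2 d : 'rV[R]_n,
  P \in unitmx & (forall i, 0 < d 0 i) /\
  forall t, dilation A t = invmx P *m diag_mx (\row_i expR (ln t * d 0 i)) *m P.
Proof.
have [P uP] := dil_diag hA.
move=> /(diagonalizable_forLR uP)[d]; rewrite mxpoly.conjumx ?unitmx_inv// invmxK => Ad.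
exists P, d => //; split => [i|t].
  apply: (dil_eigen hA); apply/eigenvalueP; exists (row i P).
    rewrite Ad !mulmxA -row_mul mulmxV// row1 -rowE row_diag_mx -scalemxAl.
    by rewrite -rowE.
  apply/eqP => /(congr1 (mulmx^~ (invmx P))).
  rewrite -row_mul mulmxV// mul0mx row1 => /(congr1 (fun v : 'rV_n => v 0 i)).
  by move/eqP; rewrite !mxE !eqxx oner_eq0.
rewrite /dilation Ad.
have -> : ln t *: (invmx P *m diag_mx d *m P) = invmx P *m diag_mx (ln t *: d) *m P.
  by rewrite linearZ /= -scalemxAr -scalemxAl.
rewrite expmx_diag//; congr (_ *m diag_mx _ *m _).
by apply/rowP => i; rewrite !mxE.
Qed.

(** Iterates of the dilation of ratio 1/2.  Working with them instead of the whole
    one-parameter group dispenses with continuity in the parameter. *)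
Definition contraction_iter (k : nat) (x : 'rV[R]_n) : 'rV[R]_n :=
  iter k (mulmx^~ (dilation A 2^-1)) x.

(** In a basis of eigenvectors the k-th iterate scales the i-th coordinate by the
    k-th power of exp (ln (1/2) d_i) < 1, as d_i > 0. *)
Lemma contraction_iter_cvg x : contraction_iter k x @[k --> \oo] --> (0 : 'rV[R]_n).
Proof.
have [P [d uP [d0 DE]]] := dilation_diag.
pose e i := expR (ln 2^-1 * d 0 i).
have E k : contraction_iter k x = \sum_i ((x *m invmx P) 0 i * e i ^+ k) *: row i P.
  elim: k => [|k ih].
    rewrite /contraction_iter /=.
    under eq_bigr do rewrite expr0 mulr1.
    rewrite -[LHS](mulmxKV uP) {1}(row_sum_delta (x *m invmx P)) mulmx_suml.
    by apply: eq_bigr => i _; rewrite -scalemxAl -rowE.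
  rewrite /contraction_iter iterS -/(contraction_iter k x) ih mulmx_suml.
  apply: eq_bigr => i _; rewrite DE -scalemxAl !mulmxA -row_mul mulmxV// row1.
  rewrite -rowE row_diag_mx -scalemxAl -rowE scalerA exprS [X in _ * X]mxE -/(e i).
  by congr (_ *: _); ring.
rewrite (funext E) -[X in _ --> X](_ : \sum_(i < n) (0 : 'rV[R]_n) = 0); last by rewrite big1.
apply: cvg_big; first exact: add_continuous.
move=> i _; rewrite -(scale0r (row i P)); apply: cvgZr_tmp.
rewrite -[X in _ --> X](mulr0 ((x *m invmx P) 0 i)); apply: cvgMr.
apply: cvg_expr; rewrite ger0_norm ?expR_ge0// /e.
rewrite -[ltRHS]expR0 ltr_expR -[ltRHS](mul0r (d 0 i)) ltr_pM2r//.
by rewrite ln_lt0// invr_gt0 ltr0n/= invf_lt1// ltr1n.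
Qed.

Variables (O : R -> 'M[R]_n) (N : 'rV[R]_n -> R).
Hypothesis hN : is_homogeneous_norm A O N.

Lemma norm_contraction_iter k x : N (contraction_iter k x) = 2^-1 ^+ k * N x.
Proof.
elim: k => [|k ih]; first by rewrite expr0 mul1r.
rewrite /contraction_iter iterS (hnorm_dilation hN)// -/(contraction_iter k x).
by rewrite ih exprS mulrA.
Qed.

Lemma contraction_unit : dilation A 2^-1 \in unitmx.
Proof. by have /(dil_aut hA)[] : 0 < 2^-1 :> R by rewrite invr_gt0. Qed.

(** For a point outside the unit ball, the iterate that precedes the first one in
    the unit ball lies in the compact shell K, on which N has a positive minimum m;
    iterating decreases N, so N was at least m at the start. *)
Lemma small_hnorm_bounded : exists2 m : R, 0 < m &
  forall x, N x < m -> `|x| <= 1.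
Proof.
have [L L0 DL] := mulmx_norm_bound n n (invmx (dilation A 2^-1)).
pose K := [set x : 'rV[R]_n | 1 <= `|x| <= L].
have cK : compact K.
  apply: bounded_closed_compact.
    exists L; split; first exact: num_real.
    by move=> M LM x /= /andP[_ xL]; apply: le_trans xL (ltW LM).
  rewrite (_ : K = (fun x : 'rV[R]_n => `|x|) @^-1` `[1, L]%classic); last first.
    by apply/seteqP; split => x; rewrite /K /= in_itv.
  apply: preimage_closed; first by move=> x _; exact: norm_continuous.
  exact: interval_closed.
have [m m0 mK] : exists2 m : R, 0 < m & forall x, K x -> m <= N x.
  have [[x0 Kx0]|K0] := pselect (K !=set0); last first.
    by exists 1 => // x Kx; exfalso; apply: K0; exists x.
  have [] := @EVT_min_rV R n N K _ cK.
  - by exists x0.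
  - by apply: continuous_subspaceT; exact: hnorm_continuous hN.
  move=> c Kc cmin; exists (N c); last by move=> x Kx; apply: cmin; exact/mem_set.
  rewrite lt_neqAle (hnorm_ge0 hN) andbT.
  apply/eqP => /esym /(hnorm_eq0 hN) c0.
  by move: Kc; rewrite c0 inE /K /= normr0 ler10.
exists m => // x Nxm; rewrite leNgt; apply/negP => x1.
have exk : exists k, `|contraction_iter k x| <= 1.
  have /cvgrPdist_le/(_ 1 ltr01) [k _ kP] := contraction_iter_cvg x.
  by exists k; have := kP k (leqnn k); rewrite /= sub0r normrN.
case: (ex_minnP exk) => -[|k] kP kmin; first by move: kP; rewrite leNgt x1.
have yk : 1 < `|contraction_iter k x|.
  by rewrite ltNge; apply/negP => /kmin; rewrite ltnn.
have : m <= N (contraction_iter k x).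
  apply: mK; rewrite /K /= (ltW yk)/=.
  rewrite -[contraction_iter k x](mulmxK contraction_unit).
  rewrite (le_trans (DL _))// -[leRHS]mulr1 ler_pM2l//.
rewrite norm_contraction_iter leNgt => /negP; apply.
apply: le_lt_trans Nxm; rewrite -[leRHS]mul1r ler_wpM2r//; first exact: hnorm_ge0 hN _.
by rewrite exprn_ile1 ?invr_ge0// invf_le1// ler1n.
Qed.

(** Some iterate of the contraction maps the ball of radius r into a small one,
    which is bounded, and the inverse of that iterate is linear. *)
Lemma hball_bounded r : exists2 M : R, 0 < M & forall x, N x < r -> `|x| <= M.
Proof.
have [m m0 mP] := small_hnorm_bounded.
have [k kr] : exists k, 2^-1 ^+ k * r < m.
  have : 2^-1 ^+ k * r @[k --> \oo] --> (0 * r : R).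
    apply: cvgMl; apply: cvg_expr; rewrite ger0_norm ?invr_ge0//.
    by rewrite invf_lt1// ltr1n.
  rewrite mul0r => /cvgrPdist_lt/(_ m m0) [k _ kP]; exists k.
  have := kP k (leqnn k); rewrite /= sub0r normrN; exact: le_lt_trans (ler_norm _).
have [L L0 DL] := mulmx_norm_bound n n (invmx (dilation A 2^-1)).
exists (L ^+ k); first by rewrite exprn_gt0.
move=> x xr.
have : `|contraction_iter k x| <= 1.
  apply: mP; rewrite norm_contraction_iter; apply: le_lt_trans kr.
  by rewrite ler_wpM2l ?exprn_ge0 ?invr_ge0// ltW.
suff : `|x| <= L ^+ k * `|contraction_iter k x|.
  move=> /le_trans + x1; apply.
  by rewrite -[leRHS]mulr1 ler_pM2l// exprn_gt0.
elim: k {kr} => [|k ih]; first by rewrite expr0 mul1r.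
apply: le_trans ih _; rewrite exprSr -mulrA ler_pM2l ?exprn_gt0//.
rewrite {1}(_ : contraction_iter k x =
  contraction_iter k.+1 x *m invmx (dilation A 2^-1)) ?DL//.
by rewrite /contraction_iter iterS mulmxK ?contraction_unit.
Qed.

Hypothesis hG : is_nilpotent_lie_group br mul.

(** By homogeneity one may assume N x + N y = 1; then x and y range over a compact
    set, on which the continuous function N (mul x y) is bounded. *)
Lemma hnorm_quasi_triangle : exists2 k : R, 0 < k &
  forall x y, N (mul x y) <= k * (N x + N y).
Proof.
have [M M0 MP] := hball_bounded 2.
have cB : compact [set x : 'rV[R]_n | `|x| <= M].
  apply: bounded_closed_compact.
    exists M; split; first exact: num_real.
    by move=> M' MM x /= xM; apply: le_trans xM (ltW MM).
  rewrite (_ : mkset _ = (fun x : 'rV[R]_n => `|x|) @^-1` `]-oo, M]%classic); last first.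
    by apply/seteqP; split => x; rewrite /= in_itv.
  apply: preimage_closed; first by move=> x _; exact: norm_continuous.
  exact: interval_closed.
have cf : continuous (fun p : 'rV[R]_n * 'rV[R]_n => N (mul p.1 p.2)).
  have cm : continuous (fun p : 'rV[R]_n * 'rV[R]_n => mul p.1 p.2).
    by apply: (continuous_mul _ _ hG) => p; [exact: cvg_fst|exact: cvg_snd].
  by move=> p; apply: (@continuous_comp _ _ _ (fun p : 'rV[R]_n * 'rV[R]_n => mul p.1 p.2) N);
    [exact: cm|exact: hnorm_continuous hN _].
have /compact_bounded[k0 [_ k0P]] := continuous_compact
  (continuous_subspaceT cf) (compact_setX cB cB).
pose k := Num.max 1 (k0 + 1).
have k_gt0 : 0 < k by rewrite lt_max ltr01.
have kP x y : `|x| <= M -> `|y| <= M -> N (mul x y) <= k.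
  move=> xM yM; apply: le_trans (ler_norm _) _; apply: (k0P k).
    by rewrite lt_max; apply/orP; right; rewrite ltrDl.
  by exists (x, y).
exists k => // x y.
have Nx := hnorm_ge0 hN x; have Ny := hnorm_ge0 hN y.
have [s0|s0] := leP (N x + N y) 0.
  have /(hnorm_eq0 hN) -> : N x = 0 by lra.
  have /(hnorm_eq0 hN) -> : N y = 0 by lra.
  rewrite (nlg_mul0l hG).
  have -> : N 0 = 0 by apply/(hnorm_eq0 hN).
  by rewrite addr0 mulr0.
set s := N x + N y.
have si : 0 < s^-1 by rewrite invr_gt0.
have := kP (x *m dilation A s^-1) (y *m dilation A s^-1).
rewrite (mul_lie_aut _ _ hG)//; last exact: (dil_aut hA).
rewrite (hnorm_dilation hN)// mulrC ler_pdivrMr//; apply; apply: MP.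
  rewrite (hnorm_dilation hN)// mulrC ltr_pdivrMr// /s; lra.
rewrite (hnorm_dilation hN)// mulrC ltr_pdivrMr// /s; lra.
Qed.

End Dilations.

(** * Twisted balls *)

Section Doubling.
Context {R : realType} {n : nat}.
Variables (br mul : 'rV[R]_n -> 'rV[R]_n -> 'rV[R]_n).
Hypothesis hG : is_nilpotent_lie_group br mul.
Variable A : 'M[R]_n.
Hypothesis hA : is_dilation_generator br A.
Variable O : R -> 'M[R]_n.
Hypothesis hO : is_rotation_group br A O.
Variable N : 'rV[R]_n -> R.
Hypothesis hN : is_homogeneous_norm A O N.

Lemma mul_rot s x y : mul (x *m O s) (y *m O s) = mul x y *m O s.
Proof. exact: mul_lie_aut hG _ _ _ (rot_aut hO s). Qed.

Lemma solve_mul a b p q : mul a p = mul b q -> p = mul (mul (- a) b) q.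
Proof.
move=> /(congr1 (mul (- a))).
by rewrite !(nlg_mulA hG) (nlg_mulNl hG) (nlg_mul0l hG).
Qed.

Definition rball r z : set 'rV[R]_n := [set mul b z | b in hball N r].

Lemma rballE r z : rball r z = [set w | hball N r (mul w (- z))].
Proof.
apply/seteqP; split => [_ [b Nb <-]|w Nw] /=.
  by rewrite -(nlg_mulA hG) (nlg_mulNr hG) (nlg_mul0r hG).
exists (mul w (- z)) => //.
by rewrite -(nlg_mulA hG) (nlg_mulNl hG) (nlg_mul0r hG).
Qed.

(** If B_r p and B_r q meet, then p is a small left translate of q, and rotations
    preserve this relation. *)
Lemma rball_meet k a b r p q v :
  (forall x y, N (mul x y) <= k * (N x + N y)) -> 0 < k ->
  N a < r -> N b < r -> mul a p = mul b q ->
  exists2 g, N g < k * (2 * r) & p *m O v = mul g (q *m O v).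
Proof.
move=> kP k0 ar br' /solve_mul ->; exists (mul (- a) b *m O v); last by rewrite mul_rot.
rewrite (hnorm_rotation hN); apply: le_lt_trans (kP _ _) _.
by rewrite ltr_pM2l// (hnormV hN); lra.
Qed.

(** Three rotation parameters of size at most t add up, whence the summand 3 in the
    constant. *)
Lemma tball_engulfing : exists2 k : R, 0 < k & forall x y t, 0 < t ->
  tball mul O N t y `&` tball mul O N t x !=set0 ->
  tball mul O N t y `<=` tball mul O N (k * t) x.
Proof.
have [k k0 kP] := hnorm_quasi_triangle br mul A hA O N hN hG.
have K0 : 0 < k * (1 + k * 2) by rewrite mulr_gt0// addr_gt0// mulr_gt0.
exists (k * (1 + k * 2) + 3); first by lra.
move=> x y t t0 [w [[s1 s1P [c Nc <-]] [u uP [d Nd /esym cd]]]] _ [s sP [b Nb <-]].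
have [g Ng gE] := rball_meet k c d t _ _ (s - s1) kP k0 Nc Nd cd.
have KE : k * (t + k * (2 * t)) = k * (1 + k * 2) * t by ring.
have Kt := mulr_gt0 K0 t0.
have [t3 Kt3] : (k * (1 + k * 2) + 3) * t = k * (1 + k * 2) * t + 3 * t /\
    0 <= k * (1 + k * 2) * t.
  by split; [ring|exact: ltW].
exists (u + (s - s1)).
  move: s1P uP sP; rewrite /= !in_itv/= t3 => /andP[? ?] /andP[? ?] /andP[? ?].
  by apply/andP; split; lra.
exists (mul b g).
  rewrite /hball /= t3; apply: le_lt_trans (kP _ _) _.
  apply: (@lt_le_trans _ _ (k * (t + k * (2 * t)))).
    by rewrite ltr_pM2l//; apply: ltrD.
  by rewrite KE; lra.
rewrite -(nlg_mulA hG) (rot_hom hO) mulmxA -gE.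
by rewrite -mulmxA -(rot_hom hO) addrC subrK.
Qed.

Lemma open_rball r z : open (rball r z).
Proof.
rewrite rballE; apply: (@open_comp _ _ (fun w => N (mul w (- z))) `]-oo, r[%classic).
  have c : continuous (fun w : 'rV[R]_n => mul w (- z)).
    apply: (continuous_mul _ _ hG); last exact: cst_continuous.
    by move=> w.
  move=> w _; apply: (@continuous_comp _ _ _ (fun w : 'rV[R]_n => mul w (- z)) N).
    exact: c.
  exact: hnorm_continuous hN _.
exact: interval_open.
Qed.

Lemma measurable_rball r z : measurable (rball r z : set (mrV n)).
Proof. exact: open_measurable_rV (open_rball r z). Qed.

Lemma hballE r : hball N r = rball r 0.
Proof.
by rewrite rballE; apply/seteqP; split => w /=; rewrite oppr0 (nlg_mul0r hG).
Qed.

Lemma measurable_hball r : measurable (hball N r : set (mrV n)).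
Proof. by rewrite hballE; exact: measurable_rball. Qed.

Lemma measurable_tball r x : measurable (tball mul O N r x : set (mrV n)).
Proof.
apply: open_measurable_rV; apply: bigcup_open => s _; exact: open_rball.
Qed.

Lemma mu_rball r z : mu n (rball r z) = mu n (hball N r).
Proof. by rewrite rballE (mu_mul_right _ _ hG)//; exact: measurable_hball. Qed.

Lemma mu_hball_fin r : (mu n (hball N r) < +oo)%E.
Proof.
have [M M0 MP] := hball_bounded br A hA O N hN r.
apply: (@le_lt_trans _ _ (mu n (box n M))).
  apply: le_measure; rewrite ?inE; [exact: measurable_hball|exact: measurable_box|].
  by move=> x /MP xM; apply/box_normP => //; exact: ltW.
by rewrite mu_box ?ltry// ltW.
Qed.

Lemma mu_hball_gt0 r : 0 < r -> (0 < mu n (hball N r))%E.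
Proof.
move=> r0; have N0 : N 0 = 0 by apply/(hnorm_eq0 hN).
have c0 : {for (0 : 'rV[R]_n), continuous N} by exact: hnorm_continuous hN _.
have /cvgrPdist_lt/(_ r r0)/nbhs_ballP[e /= e0 eP] := c0.
apply: (@lt_le_trans _ _ (mu n (box n (e / 2)))).
  rewrite mu_box ?lte_fin ?exprn_gt0//; first by rewrite mulrC divfK.
  by rewrite divr_ge0// ltW.
apply: le_measure; rewrite ?inE; [exact: measurable_box|exact: measurable_hball|].
move=> x /box_normP xe; have /eP : ball 0 e x.
  rewrite -ball_normE /= sub0r normrN; apply: le_lt_trans (xe _) _; lra.
rewrite /= N0 sub0r normrN; exact: le_lt_trans (ler_norm _).
Qed.

(** B_(rt) is the image of B_r under the dilation of ratio t, so both measures carry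
    the same factor, and a single ratio at t = 1 bounds all of them. *)
Lemma mu_hball_doubling c : 0 < c -> exists2 C : R, 0 <= C &
  forall t, 0 < t -> (mu n (hball N (c * t)) <= C%:E * mu n (hball N t))%E.
Proof.
move=> c0; have f1 : mu n (hball N 1) \is a fin_num by rewrite ge0_fin_numE// mu_hball_fin.
have fc : mu n (hball N c) \is a fin_num by rewrite ge0_fin_numE// mu_hball_fin.
have p1 : 0 < fine (mu n (hball N 1)).
  by rewrite fine_gt0// mu_hball_gt0//= mu_hball_fin.
exists (fine (mu n (hball N c)) / fine (mu n (hball N 1))).
  by rewrite divr_ge0 ?fine_ge0.
move=> t t0; have it0 : 0 < t^-1 by rewrite invr_gt0.
have [a a0 aE] := mu_linear n (dilation A t^-1) (proj1 (dil_aut hA it0)).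
have hE r : mu n (hball N (r * t)) = (a%:E * mu n (hball N r))%E.
  rewrite -aE; last exact: measurable_hball.
  congr (mu n _); apply/seteqP; split => x; rewrite /hball /= (hnorm_dilation hN)//.
    by rewrite [t^-1 * _]mulrC ltr_pdivrMr.
  by rewrite [t^-1 * _]mulrC ltr_pdivrMr.
have hE1 := hE 1; rewrite mul1r in hE1.
rewrite hE hE1 -(fineK f1) -(fineK fc) -!EFinM lee_fin.
by rewrite le_eqVlt; apply/orP; left; apply/eqP; field; rewrite gt_eqF.
Qed.

Fixpoint ball_union r (s : seq 'rV[R]_n) : set 'rV[R]_n :=
  if s is z :: s' then rball r z `|` ball_union r s' else set0.

Lemma measurable_ball_union r s : measurable (ball_union r s : set (mrV n)).
Proof.
elim: s => [|z s ih] /=; first exact: measurable0.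
by apply: measurableU => //; exact: measurable_rball.
Qed.

Lemma ball_unionP r s w : ball_union r s w <-> exists2 z, z \in s & rball r z w.
Proof.
elim: s => [|z s ih] /=; first by split => // -[].
split=> [[zw|/ih[z' z's z'w]]|[z']].
- by exists z => //; exact: mem_head.
- by exists z' => //; rewrite inE z's orbT.
by rewrite inE => /orP[/eqP->|z's] z'w; [left|right; apply/ih; exists z'].
Qed.

Lemma mu_ball_union_le r s :
  (mu n (ball_union r s) <= (size s)%:R%:E * mu n (hball N r))%E.
Proof.
elim: s => [|z s ih] /=; first by rewrite measure0 mul0e.
apply: (@le_trans _ _ (mu n (rball r z) + mu n (ball_union r s))%E).
  by apply: measureU2; [exact: measurable_rball|exact: measurable_ball_union].
rewrite mu_rball -natr1 EFinD ge0_muleDl// mul1e addeC.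
by rewrite leeD2r.
Qed.

Fixpoint packing r (s : seq 'rV[R]_n) : Prop :=
  if s is z :: s' then
    (forall z', z' \in s' -> rball r z `&` rball r z' = set0) /\ packing r s'
  else True.

Lemma mu_ball_union_packing r s : packing r s ->
  mu n (ball_union r s) = ((size s)%:R%:E * mu n (hball N r))%E.
Proof.
elim: s => [|z s ih] /=; first by rewrite measure0 mul0e.
move=> [zs ps]; rewrite measureU; first last.
- apply/seteqP; split => // w [zw /ball_unionP[z' z's z'w]].
  by rewrite -(zs z' z's).
- exact: measurable_ball_union.
- exact: measurable_rball.
rewrite [X in (X + _)%E]mu_rball [X in (_ + X)%E]ih// -natr1 EFinD ge0_muleDl//.
by rewrite mul1e addeC.
Qed.

(** A family that is not maximal can be enlarged, so without a maximal one there are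
    disjoint families of every size. *)
Lemma packing_dichotomy r (K : set 'rV[R]_n) :
  (forall m, exists s, [/\ size s = m, packing r s & {in s, forall z, K z}]) \/
  exists s, [/\ packing r s, {in s, forall z, K z} &
    forall z, K z -> exists2 z', z' \in s & rball r z `&` rball r z' !=set0].
Proof.
have [h|h] := pselect (exists s, [/\ packing r s, {in s, forall z, K z} &
    forall z, K z -> exists2 z', z' \in s & rball r z `&` rball r z' !=set0]).
  by right.
left; elim=> [|m [s [sm ps sK]]]; first by exists [::]; split.
have [z Kz zs] : exists2 z, K z & forall z', z' \in s -> rball r z `&` rball r z' = set0.
  apply: contrapT => nz; apply: h; exists s; split => // z Kz.
  apply: contrapT => nz'; apply: nz; exists z => // z' z's.
  apply/eqP; apply: contrapT => /negP/set0P zz'; apply: nz'; by exists z'.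
exists (z :: s); split => //=; first by rewrite sm.
by move=> z'; rewrite inE => /orP[/eqP->//|]; exact: sK.
Qed.

(** Points O_u x with |u| <= 2t are rotations by t or -t of points O_s x with
    |s| <= t.  The invariance of the balls under rotations therefore reduces the
    doubled range of parameters to the original one at the price of a factor 2. *)
Lemma tball_doubling : exists2 C : R, 0 < C & forall x t, 0 < t ->
  (mu n (tball mul O N (2 * t) x) <= C%:E * mu n (tball mul O N t x))%E.
Proof.
have [k k0 kP] := hnorm_quasi_triangle br mul A hA O N hN hG.
have c0 : 0 < k * (2 + k * 2) by rewrite mulr_gt0// addr_gt0// mulr_gt0.
have [C C0 CP] := mu_hball_doubling _ c0.
exists (2 * C + 1) => [|x t t0]; first by lra.
have C1 : 0 < 2 * C + 1 by lra.
pose K : set 'rV[R]_n := [set x *m O s | s in `[- t, t]].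
have unionK s : {in s, forall z, K z} -> ball_union t s `<=` tball mul O N t x.
  move=> sK w /ball_unionP[z /sK[u uP <-] zw]; by exists u.
have [big|[s [ps sK smax]]] := packing_dichotomy t K.
  suff -> : mu n (tball mul O N t x) = +oo%E by rewrite gt0_muley ?leey// lte_fin.
  apply/eqP; rewrite -leye_eq leNgt; apply/negP => fin.
  have ft : mu n (tball mul O N t x) \is a fin_num by rewrite ge0_fin_numE.
  have fh : mu n (hball N t) \is a fin_num by rewrite ge0_fin_numE// mu_hball_fin.
  have h0 : 0 < fine (mu n (hball N t)).
    by rewrite fine_gt0// mu_hball_gt0//= mu_hball_fin.
  pose q := fine (mu n (tball mul O N t x)) / fine (mu n (hball N t)).
  have [s [sm ps sK]] := big (Num.truncn q).+1.
  have : (mu n (ball_union t s) <= mu n (tball mul O N t x))%E.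
    exact: le_measure (mem_set (measurable_ball_union t s))
      (mem_set (measurable_tball t x)) (unionK s sK).
  rewrite mu_ball_union_packing// sm -(fineK ft) -(fineK fh) -EFinM lee_fin.
  rewrite -ler_pdivlMr// leNgt => /negP; apply; exact: truncnS_gt.
pose s2 := map (mulmx^~ (O t)) s ++ map (mulmx^~ (O (- t))) s.
have sub : tball mul O N (2 * t) x `<=` ball_union (k * (2 + k * 2) * t) s2.
  move=> _ [u uP [b Nb <-]].
  have [e e_t ue] : exists2 e, e = t \/ e = - t & u - e \in `[- t, t].
    move: uP; rewrite /= in_itv/= => /andP[u1 u2].
    have [u0|u0] := leP 0 u.
      by exists t; [left|rewrite in_itv/=; apply/andP; split; lra].
    by exists (- t); [right|rewrite in_itv/=; apply/andP; split; lra].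
  have [z zs [w [[a1 Na1 <-] [a2 Na2 /esym a12]]]] :
     exists2 z', z' \in s & rball t (x *m O (u - e)) `&` rball t z' !=set0.
    by apply: smax; exists (u - e).
  have [g Ng gE] := rball_meet k a1 a2 t _ _ e kP k0 Na1 Na2 a12.
  apply/ball_unionP; exists (z *m O e).
    by rewrite mem_cat; case: e_t => ->; apply/orP; [left|right]; apply/mapP; exists z.
  exists (mul b g); last first.
    by rewrite -(nlg_mulA hG) -gE -mulmxA -(rot_hom hO) subrK.
  rewrite /hball /=; apply: le_lt_trans (kP _ _) _.
  rewrite -mulrA ltr_pM2l// mulrDl ltrD//.
  by rewrite -mulrA.
apply: le_trans (le_measure (mu n) (mem_set (measurable_tball _ _))
    (mem_set (measurable_ball_union _ _)) sub) _.
apply: le_trans (mu_ball_union_le _ _) _.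
have -> : size s2 = (2 * size s)%N by rewrite size_cat !size_map mul2n addnn.
apply: le_trans (lee_wpmul2l _ (CP t t0)) _; first by rewrite lee_fin.
have -> : ((2 * size s)%:R%:E * (C%:E * mu n (hball N t)) =
   (2 * C)%:E * ((size s)%:R%:E * mu n (hball N t)))%E.
  by rewrite !muleA -!EFinM natrM; congr (_%:E * _)%E; ring.
rewrite -mu_ball_union_packing//.
apply: (@le_trans _ _ ((2 * C)%:E * mu n (tball mul O N t x))%E).
  apply: lee_wpmul2l; first by rewrite lee_fin mulr_ge0.
  exact: le_measure (mem_set (measurable_ball_union t s)) (mem_set (measurable_tball t x))
    (unionK s sK).
by rewrite lee_wpmul2r// lee_fin; lra.
Qed.

End Doubling.

Theorem theorem5 (R : realType) (n : nat) (hn : (2 <= n)%N)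
    (br mul : 'rV[R]_n -> 'rV[R]_n -> 'rV[R]_n)
    (hG : is_nilpotent_lie_group br mul)
    (A : 'M[R]_n) (hA : is_dilation_generator br A)
    (O : R -> 'M[R]_n) (hO : is_rotation_group br A O)
    (N : 'rV[R]_n -> R) (hN : is_homogeneous_norm A O N) :
  exists C k : R, [/\ 0 < C, 0 < k &
    forall (x y : 'rV[R]_n) (t : R), 0 < t ->
      (tball mul O N t y `&` tball mul O N t x !=set0 ->
         tball mul O N t y `<=` tball mul O N (k * t) x) /\
      (lebesgue_rV (tball mul O N (2 * t) x) <=
         C%:E * lebesgue_rV (tball mul O N t x))%E].
Proof.
have [k k0 kP] := tball_engulfing br mul hG A hA O hO N hN.
have [C C0 CP] := tball_doubling br mul hG A hA O hO N hN.
exists C, k; split => // x y t t0; split; first exact: kP.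
by rewrite !lebesgue_rVE; [exact: CP| |]; exact: (measurable_tball br mul hG A O N hN).
Qed.
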